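(* There is an absolute constant $C>0$ such that the following holds. For any $\varepsilon\in(0,1)$, let $X$ be an affine source on $\{0,1\}^n$ of entropy $k\ge C\log(1/\varepsilon)$, and let $L:\{0,1\}^n\to\{0,1\}^d$ with $d\le n$ be an affine function such that $Y=L(X)$ is uniform. Then there exists a function $\mathsf{AffineAdvGen}:\{0,1\}^n\times\{0,1\}^d\to\{0,1\}^a$ with $a\le C\log(1/\varepsilon)$ such that for any affine function $\mathcal{A}:\{0,1\}^n\to\{0,1\}^n$ without fixed points, setting $X'=\mathcal{A}(X)$ and $Y'=L(X')$, it holds that $\Pr[\mathsf{AffineAdvGen}(X,Y)\neq\mathsf{AffineAdvGen}(X',Y')]\ge 1-\varepsilon$.
   Context: An affine source on $\{0,1\}^n=\mathbb{F}_2^n$ is the uniform distribution over an affine subspace; its entropy is the subspace dimension. Affine functions are maps $x\mapsto Mx+b$ over $\mathbb{F}_2$; $\mathcal{A}$ has no fixed points if $\mathcal{A}(x)\neq x$ for all $x$.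
   Formalization: The bound on a is proved as a ≤ max(1, C log(1/ε)) instead of a ≤ C log(1/ε): when ε is so close to 1 that C log(1/ε) < 1, the literal bound forces a = 0, a constant function, and probability 0 < 1 − ε. *)

(* Defs.v *)
From HB Require Import structures.
From mathcomp Require Import all_boot all_order all_algebra.
From mathcomp Require Import all_classical all_reals all_analysis.

Set Implicit Arguments.
Unset Strict Implicit.
Unset Printing Implicit Defensive.

Import Order.TTheory GRing.Theory Num.Theory.
Local Open Scope ring_scope.

Notation bits n := 'cV['F_2]_n.

Definition log2 (R : realType) (x : R) : R := ln x / ln 2.

Definition is_affine_map (n m : nat) (f : bits n -> bits m) : Prop :=
  exists (M : 'M['F_2]_(m, n)) (b : bits m), forall x, f x = M *m x + b.

Definition is_affine_subspace (n : nat) (S : {set bits n}) (k : nat) : Prop :=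
  exists (v : bits n) (U : {vspace bits n}),
    \dim U = k /\ forall x, (x \in S) = (x - v \in U).

(* Distributions on a finite type are given by their mass functions. *)

Definition unif (R : realType) (T : finType) (S : {set T}) : T -> R :=
  fun x => if x \in S then #|S|%:R^-1 else 0.

Definition Pr (R : realType) (T : finType) (P : T -> R) (E : pred T) : R :=
  \sum_(x | E x) P x.

Definition law (R : realType) (T U : finType) (P : T -> R) (f : T -> U) : U -> R :=
  fun y => Pr P [pred x | f x == y].

Definition is_affine_source (R : realType) (n : nat) (X : bits n -> R) (k : nat) : Prop :=
  exists S : {set bits n}, is_affine_subspace S k /\ forall x, X x = unif R S x.

(* Main.v *)
(** Only the map x |-> AdvGen (x, L x) matters.  Identify the source with F_2^k by an affine
parametrisation, set the generator to 0 off the source and choose it by a union bound on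
the source.  Restricted to the points staying in the source, A becomes a partial affine map
of F_2^k, of which there are at most 2^(2k^2+2k+1), whatever n is.  A fixed-point-free map
collides on a given set E for at most a q^(-|E|/2) fraction of the generators: on at least
half of E it is monotone for a fixed enumeration of F_2^k, and there the values of the
generator are determined recursively by the others.  Summing over the sets E of size
eps 2^k gives O(log(1/eps)) output bits.  When eps is close to 1 only one bit is available:
the same bound with |E| = (1 - 1/32) 2^k works if k >= 20, and the indicator of one point
of the source works if k < 20. *)

Require Import Defs.
From HB Require Import structures.
From mathcomp Require Import all_boot all_order all_algebra.
From mathcomp Require Import all_classical all_reals all_analysis.
From mathcomp Require Import zify lra.

Set Implicit Arguments.
Unset Strict Implicit.
Unset Printing Implicit Defensive.

Import Order.TTheory GRing.Theory Num.Theory.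
Local Open Scope ring_scope.

(** * Counting functions that collide along a partial map without fixed points *)

Section Collisions.
Variables (V W : finType) (w0 : W).
Implicit Types (p : V -> option V) (G : {ffun V -> W}) (D E : {set V}).

(** [None] stands for a point sent outside the source, where the generator takes the constant value
    [w0]. *)
Definition eval_default G (o : option V) : W := if o is Some v then G v else w0.

Definition collisions p G : {set V} := [set u | G u == eval_default G (p u)].

(** On [D] each value of [G] is either [w0] or the value at a point of smaller rank, so by induction
    on [r] the restriction of [G] to the complement of [D] determines [G]. *)
Lemma card_collisions_wf p (r : V -> nat) D :
  (forall u v, u \in D -> p u = Some v -> (r v < r u)%N) ->
  (#|[set G | D \subset collisions p G]| <= #|W| ^ (#|V| - #|D|))%N.
Proof.
move=> rD; pose f G : {ffun V -> W} := [ffun u => if u \in D then w0 else G u].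
have injf : {in [set G | D \subset collisions p G] &, injective f}.
  move=> G1 G2; rewrite !inE => /fintype.subsetP D1 /fintype.subsetP D2 /ffunP eqf.
  apply/ffunP => u; have [m] := ubnP (r u); elim: m u => // m IH u ltu.
  have [uD|uD] := boolP (u \in D); last by move: (eqf u); rewrite !ffunE (negPf uD).
  move: (D1 u uD) (D2 u uD); rewrite !inE => /eqP -> /eqP ->.
  case E: (p u) => [v|] //=; apply: IH; exact: leq_trans (rD u v uD E) _.
have -> : (#|V| - #|D| = #|~: D|)%N by rewrite (cardsCs (~: D)) finset.setCK.
rewrite -(card_in_imset injf) -(card_pffun_on w0).
apply/subset_leq_card/fintype.subsetP => _ /imsetP [G _ ->].
apply/pffun_onP; split=> //; apply/fintype.subsetP => u.
by rewrite !inE ffunE; case: (u \in D); rewrite // eqxx.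
Qed.

(** Without fixed points, [p] either lowers the rank (or is undefined) or raises it. One of these
    two parts of [E] contains at least half of it, and there the previous count applies. *)
Lemma card_collisions p E :
  (0 < #|W|)%N -> (forall u, p u <> Some u) ->
  (#|[set G | E \subset collisions p G]| <= #|W| ^ (#|V| - uphalf #|E|))%N.
Proof.
move=> W0 pfree; pose r (u : V) : nat := enum_rank u.
pose D := [set u in E | if p u is Some v then (r v < r u)%N else true].
have rlt u : (r u < #|V|)%N by exact: ltn_ord.
have key D' s : D' \subset E -> (uphalf #|E| <= #|D'|)%N ->
    (forall u v, u \in D' -> p u = Some v -> (s v < s u)%N) ->
    (#|[set G | E \subset collisions p G]| <= #|W| ^ (#|V| - uphalf #|E|))%N.
  move=> sD'E leD' sP; apply: leq_trans (leq_trans (card_collisions_wf sP) _).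
    apply/subset_leq_card/fintype.subsetP => G; rewrite !inE.
    exact: fintype.subset_trans.
  by rewrite leq_pexp2l // leq_sub2l.
have sDE : D \subset E by apply/fintype.subsetP => u; rewrite inE => /andP[].
have cE : (#|E :&: D| + #|E :\: D| = #|E|)%N by exact: cardsID.
rewrite (finset.setIidPr sDE) in cE.
have [leD|ltD] := leqP (uphalf #|E|) #|D|.
  by apply: (key D r) => // u v; rewrite inE => /andP[_ +] pu; rewrite pu.
(* Where [p] raises the rank, the reversed enumeration decreases. *)
apply: (key (E :\: D) (fun u => #|V| - r u)%N); first exact: finset.subsetDl.
  by lia.
move=> u v; rewrite !inE => /andP[+ uE] pu; rewrite uE pu /= -leqNgt => le.
have ne : r u <> r v by move=> /ord_inj /enum_rank_inj eq; apply: (pfree u); rewrite {2}eq.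
move: (rlt u) (rlt v) le ne; move: (r u) (r v) #|V| => x y z /=; lia.
Qed.

(** Union bound over the indices and the sets of size [t]: a map with at least [t] collisions
    collides on a whole set of size [t]. *)
Lemma exists_few_collisions (I : finType) (p : I -> V -> option V) (t : nat) :
  (t <= #|V|)%N ->
  (#|I| * 'C(#|V|, t) < #|W| ^ uphalf t)%N ->
  exists G, forall i, (forall u, p i u <> Some u) -> (#|collisions (p i) G| < t)%N.
Proof.
move=> tV small.
have W0 : (0 < #|W|)%N by apply/card_gt0P; exists w0.
pose good i := [forall u, p i u != Some u].
pose bad i E := if good i then [set G | E \subset collisions (p i) G] else finset.set0.
pose B := \bigcup_(i : I) \bigcup_(E : {set V} | #|E| == t) bad i E.
have cB : (#|B| <= #|I| * ('C(#|V|, t) * #|W| ^ (#|V| - uphalf t)))%N.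
  have le1 (J : finType) (P : pred J) (F : J -> {set {ffun V -> W}}) c :
      (forall j, P j -> #|F j| <= c)%N -> (#|\bigcup_(j | P j) F j| <= #|P| * c)%N.
    move=> leF; rewrite -sum_nat_const.
    elim/big_ind2: _ => [|A a A' a' leA leA'|j /leF //]; first by rewrite cards0.
    by apply: leq_trans (leq_card_setU _ _) _; rewrite leq_add.
  apply: leq_trans (le1 _ _ _ ('C(#|V|, t) * #|W| ^ (#|V| - uphalf t))%N _) _; last by [].
  move=> i _; rewrite -card_draws -[#|[set _ | _]|]cardsE.
  apply: leq_trans (le1 _ _ _ (#|W| ^ (#|V| - uphalf t))%N _) _.
    move=> E /eqP <-; rewrite /bad; case: ifP; last by rewrite cards0.
    by move=> /forallP gi; apply: card_collisions => // u; apply/eqP/gi.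
  by rewrite leq_mul2r; apply/orP; right; apply/subset_leq_card/fintype.subsetP => E; rewrite !inE.
have : (#|B| < #|[set: {ffun V -> W}]|)%N.
  rewrite cardsT card_ffun; apply: leq_ltn_trans cB _.
  have h : (uphalf t <= #|V|)%N by lia.
  by rewrite -[X in (_ < _ ^ X)%N](subnKC h) expnD mulnA ltn_mul2r small expn_gt0 W0.
case: (fintype.pickP (fun G => G \notin B)) => [G GB _|all_bad].
  exists G => i gi; rewrite ltnNge; apply: contra GB => le.
  have [E [sE cE]] : exists E : {set V}, E \subset collisions (p i) G /\ #|E| = t.
    have [s [us ss sz]] : exists s, [/\ uniq s, {subset s <= collisions (p i) G} & size s = t].
      exists (take t (enum (collisions (p i) G))); split.
      - by rewrite take_uniq // enum_uniq.
      - by move=> x /mem_take; rewrite mem_enum.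
      - by rewrite size_takel // -cardE.
    exists [set x in s]; split; first by apply/fintype.subsetP => x; rewrite inE => /ss.
    by rewrite cardsE (card_uniqP us).
  apply/finset.bigcupP; exists i => //; apply/finset.bigcupP; exists E; first by rewrite cE.
  rewrite /bad; have -> : good i by apply/forallP => u; apply/eqP/gi.
  by rewrite inE.
rewrite ltnNge subset_leq_card //; apply/fintype.subsetP => G _.
by have := all_bad G => /negbFE.
Qed.

End Collisions.

(** * Binomial coefficients at powers of two *)

Lemma expnS_le4 (e : nat) : ((2 ^ e).+1 ^ (2 ^ e) <= 4 * (2 ^ e) ^ (2 ^ e))%N.
Proof.
case: e => [//|e]; rewrite expnS; set h := (2 ^ e)%N.
(* Bernoulli's inequality for [(1 - 1/(m+1))^i], cleared of denominators. At [m = 2h], [i = h] it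
   bounds [(1 + 1/m)^h] by 2, and squaring gives 4. *)
have bern m i : (i <= m)%N -> (m.+1 ^ i * (m.+1 - i) <= m.+1 * m ^ i)%N.
  elim: i => [|i IH] lei; first by rewrite !expn0 subn0 mul1n muln1.
  have := IH (ltnW lei); rewrite !expnS.
  move: (m.+1 ^ i)%N (m ^ i)%N => x y le.
  have : (m * (x * (m.+1 - i)) <= m * (m.+1 * y))%N by rewrite leq_mul2l le orbT.
  have [j ->] : exists j, m = (i.+1 + j)%N by exists (m - i.+1)%N; lia.
  have -> : ((i.+1 + j).+1 - i = j.+2)%N by lia.
  have -> : ((i.+1 + j).+1 - i.+1 = j.+1)%N by lia.
  nia.
have half : ((2 * h).+1 ^ h <= 2 * (2 * h) ^ h)%N.
  have := bern (2 * h)%N h (leq_pmull _ _); have -> : ((2 * h).+1 - h = h.+1)%N by lia.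
  move: ((2 * h).+1 ^ h)%N ((2 * h) ^ h)%N => x y /(_ isT) le.
  rewrite leqNgt; apply/negP => lt; have := leq_mul lt (leqnn h.+1); nia.
have expn2 x : (x ^ (2 * h) = x ^ h * x ^ h)%N by rewrite mul2n -addnn expnD.
by rewrite !expn2 -[4%N]/(2 * 2)%N mulnACA leq_mul.
Qed.

(** With [m = 2^e] and [2^k = m t], the coefficient times [m^(mt - t)] is one term of the expansion
    of [(m+1)^(mt)], which is at most [(4 m^m)^t]. *)
Lemma bin_pow2_le (k e : nat) : (e <= k)%N ->
  ('C(2 ^ k, 2 ^ (k - e)) <= 2 ^ ((e + 2) * 2 ^ (k - e)))%N.
Proof.
move=> lek; set t := (2 ^ (k - e))%N; set m := (2 ^ e)%N.
have Nmt : (2 ^ k = m * t)%N by rewrite -expnD subnKC.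
have m0 : (0 < m)%N by rewrite expn_gt0.
have tN : (t <= m * t)%N by rewrite leq_pmull.
rewrite Nmt.
have : ('C(m * t, t) * m ^ (m * t - t) <= m.+1 ^ (m * t))%N.
  rewrite -addn1 expnDn.
  have tO : (t < (m * t).+1)%N by [].
  by rewrite (bigD1 (Ordinal tO)) //= exp1n muln1 leq_addr.
move=> le; rewrite -(@leq_pmul2r (m ^ (m * t - t))) ?expn_gt0 ?m0 //.
apply: leq_trans le _; rewrite expnM.
apply: (@leq_trans ((4 * m ^ m) ^ t)); first by rewrite leq_exp2r ?expn_gt0 // expnS_le4.
rewrite expnMn -expnM -{1}(subnKC tN) expnD mulnA leq_mul2r; apply/orP; right.
by rewrite expnM expnD -/m expnMn mulnC; exact: leqnn.
Qed.

(** * Coordinates on the source and the partial affine maps induced on them *)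

Lemma affine_subspace_param (n k : nat) (S : {set bits n}) :
  is_affine_subspace S k ->
  exists (v : bits n) (F : 'M['F_2]_(n, k)) (F' : 'M['F_2]_(k, n)),
    F' *m F = 1%:M /\ S = [set F *m u + v | u : bits k].
Proof.
move=> [v [U [dU SU]]]; subst k.
(* The columns of [F] are a basis of [U], hence [F] has a left inverse. *)
pose F := \matrix_(i < n, j < \dim U) (vbasis U)`_j i 0.
have FE (u : bits (\dim U)) : F *m u = \sum_(j < \dim U) u j 0 *: (vbasis U)`_j.
  apply/matrixP => i z; rewrite !mxE summxE (ord1 z).
  by apply: eq_bigr => j _; rewrite !mxE mulrC.
have /row_freeP [B FB] : row_free F^T.
  apply: inj_row_free => w /(congr1 trmx); rewrite trmx_mul trmxK trmx0 FE => w0.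
  have /freeP /(_ (fun j => w^T j 0) w0) w00 := basis_free (vbasisP U).
  by apply/matrixP => z j; have := w00 j; rewrite !mxE (ord1 z).
exists v, F, B^T; split; first by rewrite -[F]trmxK -trmx_mul FB trmx1.
apply/setP => x; rewrite SU; apply/idP/imsetP => [xU|[u _ ->]].
  exists (\col_j coord (vbasis U) j (x - v)) => //; rewrite FE.
  under eq_bigr do rewrite mxE.
  by rewrite -coord_vbasis // subrK.
rewrite addrK FE rpred_sum // => j _; rewrite rpredZ //.
by rewrite vbasis_mem // mem_nth // size_tuple.
Qed.

Definition pcode (k : nat) : finType :=
  (bool * ('M['F_2]_k * bits k) * ('M['F_2]_k * bits k))%type.

(* The code ((b, (H, u0)), (M, c)) stands for the partial affine map u |-> M u + c
   with domain u0 + ker H if b holds, and for the nowhere defined map otherwise. *)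
Definition partial_affine (k : nat) (c : pcode k) (u : bits k) : option (bits k) :=
  let: (b, (H, u0), (M, w)) := c in
  if b && (H *m (u - u0) == 0) then Some (M *m u + w) else None.

Lemma card_bits k : #|{: bits k}| = (2 ^ k)%N.
Proof. by rewrite card_mx card_Fp // muln1. Qed.

Lemma card_pcode k : #|pcode k| = (2 ^ (2 * k * k + 2 * k + 1))%N.
Proof.
rewrite !card_prod card_bool !card_mx card_Fp // muln1 -[X in (X * _ * _)%N]expn1 -!expnD.
congr (2 ^ _)%N; lia.
Qed.

Section Param.
Variables (n k : nat) (v : bits n) (F : 'M['F_2]_(n, k)) (F' : 'M['F_2]_(k, n)).
Hypothesis FK : F' *m F = 1%:M.

Definition param (u : bits k) : bits n := F *m u + v.
Definition coordinates (x : bits n) : option (bits k) :=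
  if F *m (F' *m (x - v)) == x - v then Some (F' *m (x - v)) else None.

Lemma paramK u : coordinates (param u) = Some u.
Proof. by rewrite /coordinates /param addrK [F' *m _]mulmxA FK mul1mx eqxx. Qed.

Lemma coordinatesK x u : coordinates x = Some u -> param u = x.
Proof. by rewrite /coordinates; case: eqP => // e [<-]; rewrite /param e subrK. Qed.

Lemma param_inj : injective param.
Proof. by move=> u1 u2 /(congr1 coordinates); rewrite !paramK => -[]. Qed.

(** Since [F *m F'] projects onto the direction space of the source, [A (param u)] lies in the
    source exactly when the affine equation [K *m u + c = 0] holds. *)
Lemma affine_map_restricts (A : bits n -> bits n) : is_affine_map A ->
  exists c : pcode k, forall u, partial_affine c u = coordinates (A (param u)).
Proof.
move=> [M [b AE]].
pose K := (1%:M - F *m F') *m M *m F.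
pose c := (1%:M - F *m F') *m (M *m v + b - v).
have aff u : A (param u) - v = M *m F *m u + (M *m v + b - v).
  by rewrite AE /param mulmxDr mulmxA !addrA.
have domE u : (F *m (F' *m (A (param u) - v)) == A (param u) - v) = (K *m u + c == 0).
  have -> : K *m u + c = (1%:M - F *m F') *m (A (param u) - v).
    by rewrite aff mulmxDr /K !mulmxA.
  by rewrite mulmxBl mul1mx mulmxA subr_eq0 eq_sym.
have valE u : F' *m (A (param u) - v) = F' *m M *m F *m u + F' *m (M *m v + b - v).
  by rewrite aff mulmxDr !mulmxA.
case: (fintype.pickP (fun u => K *m u + c == 0)) => [u0 /eqP u0K|none]; last first.
  exists (false, (0, 0), (0, 0)) => u; rewrite /coordinates domE none //.
(* [K] has [n] rows; the square matrix [<<K>>] of size [k] has the same row space, hence the same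
   kernel on columns, so the code does not depend on [n]. *)
exists (true, (<<K>>%MS, u0), (F' *m M *m F, F' *m (M *m v + b - v))) => u /=.
rewrite /coordinates domE valE.
have -> // : (<<K>>%MS *m (u - u0) == 0) = (K *m u + c == 0).
have -> : K *m u + c = K *m (u - u0).
  by rewrite mulmxBr; congr (_ + _); apply/eqP; rewrite -addr_eq0 addrC u0K.
have /submxP [D1 e1] : (<<K>> <= K)%MS by rewrite genmxE.
have /submxP [D2 e2] : (K <= <<K>>)%MS by rewrite genmxE.
apply/eqP/eqP => e.
  by rewrite e2 -mulmxA e mulmx0.
by rewrite e1 -mulmxA e mulmx0.
Qed.

Definition advgen (a : nat) (G : {ffun bits k -> bits a}) (x : bits n) : bits a :=
  eval_default 0 G (coordinates x).

Lemma advgen_param a (G : {ffun bits k -> bits a}) u : advgen G (param u) = G u.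
Proof. by rewrite /advgen paramK. Qed.

Lemma exists_advgen (a t : nat) : (t <= 2 ^ k)%N ->
  (2 ^ (2 * k * k + 2 * k + 1) * 'C(2 ^ k, t) < (2 ^ a) ^ uphalf t)%N ->
  exists g : bits n -> bits a, forall A, is_affine_map A -> (forall x, A x <> x) ->
    (2 ^ k - t < #|[set u | g (param u) != g (A (param u))]|)%N.
Proof.
move=> tN small.
have [] := @exists_few_collisions (bits k) (bits a) 0 (pcode k) (@partial_affine k) t.
- by rewrite card_bits.
- by rewrite card_pcode !card_bits.
move=> G GP; exists (advgen G) => A afA fixA.
have [c cE] := affine_map_restricts afA.
have : (#|collisions 0%R (partial_affine c) G| < t)%N.
  by apply: GP => u; rewrite cE => /coordinatesK /esym /fixA.
have -> : [set u | advgen G (param u) != advgen G (A (param u))] = ~: collisions 0 (partial_affine c) G.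
  by apply/setP => u; rewrite !inE advgen_param cE.
rewrite [#|~: _|]cardsCs finset.setCK card_bits; lia.
Qed.

End Param.

(** * Probabilities on the source and the numerical form of the union bound *)

Lemma Pr_unif_image (R : realType) (T V : finType) (f : V -> T) (E : pred T) :
  injective f ->
  Pr (unif R [set f u | u : V]) E = #|[set u | E (f u)]|%:R / #|V|%:R.
Proof.
move=> injf; rewrite /Pr /unif -big_mkcondr /= sumr_const card_imset //.
rewrite mulr_natl; congr (_ *+ _).
rewrite -(card_imset _ injf) -cardsE; congr #|pred_of_set _|.
apply/setP => x; rewrite !inE; apply/andP/imsetP => [[Ex /imsetP [u _ e]]|[u]].
  by exists u; rewrite // inE -e.
by rewrite inE => Eu ->; split=> //; apply/imsetP; exists u.
Qed.

(** For [k <= 2j] the left side dominates [2k^2 + 2k + 1], the exponent in the number of codes. *)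
Lemma quad_lt_pow2 j : (10 <= j)%N -> (8 * j * j + 4 * j + 1 < 2 ^ j)%N.
Proof.
elim: j => // j IH; rewrite leq_eqVlt => /orP [/eqP <- //|lt].
have := IH lt; rewrite expnS; nia.
Qed.

(** With [t = 2^(k-e)], the codes contribute less than [t] to the exponent and the binomial at most
    [(e+2) t]; [2(e+3)] output bits pay for the sum, as only half of [t] counts. *)
Lemma union_bound_small_eps k e : (20 + 2 * e <= k)%N ->
  (2 ^ (2 * k * k + 2 * k + 1) * 'C(2 ^ k, 2 ^ (k - e))
   < (2 ^ (2 * (e + 3))) ^ uphalf (2 ^ (k - e)))%N.
Proof.
move=> lek; have ek : (e <= k)%N by lia.
apply: leq_ltn_trans (leq_mul (leqnn _) (bin_pow2_le ek)) _.
rewrite -expnD -expnM ltn_exp2l //.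
have : (8 * (k - e) * (k - e) + 4 * (k - e) + 1 < 2 ^ (k - e))%N by apply: quad_lt_pow2; lia.
have : (k <= 2 * (k - e))%N by lia.
move: (2 ^ (k - e))%N (k - e)%N => t j kj jt.
have : (k * k <= 2 * j * (2 * j))%N by apply: leq_mul.
have : (t <= 2 * uphalf t)%N by lia.
move: (uphalf t) => h th kk.
have : ((e + 3) * t <= (e + 3) * (2 * h))%N by rewrite leq_mul2l th orbT.
nia.
Qed.

(** With [s = 2^(k-5)], the exponents on the left add up to less than [s + 7s], while half of [31s]
    is available on the right. *)
Lemma union_bound_one_bit k : (20 <= k)%N ->
  (2 ^ (2 * k * k + 2 * k + 1) * 'C(2 ^ k, 2 ^ k - 2 ^ (k - 5))
   < (2 ^ 1) ^ uphalf (2 ^ k - 2 ^ (k - 5)))%N.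
Proof.
move=> lek; have ek : (5 <= k)%N by lia.
have le2 : (2 ^ (k - 5) <= 2 ^ k)%N by rewrite leq_exp2l // leq_subr.
rewrite bin_sub //.
apply: leq_ltn_trans (leq_mul (leqnn _) (bin_pow2_le ek)) _.
rewrite -expnD expn1 ltn_exp2l //.
have : (8 * (k - 5) * (k - 5) + 4 * (k - 5) + 1 < 2 ^ (k - 5))%N by apply: quad_lt_pow2; lia.
have e2 : (2 ^ k = 32 * 2 ^ (k - 5))%N by rewrite -{1}(subnKC ek) expnD.
have kj : (k <= 2 * (k - 5))%N by lia.
rewrite e2; move: kj; move: (2 ^ (k - 5))%N (k - 5)%N => t j kj jt.
have : (k * k <= 2 * j * (2 * j))%N by apply: leq_mul.
lia.
Qed.

Lemma pow2_ge_inv (R : realType) (eps : R) : 0 < eps < 1 ->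
  let e := (Num.trunc (log2 (1 / eps))).+1 in
  2 ^- e <= eps /\ e%:R <= log2 (1 / eps) + 1.
Proof.
move=> /andP [eps0 eps1] e; set l := log2 _ in e *.
have ln20 : 0 < ln 2 :> R by rewrite ln_gt0 // ltr1n.
have lE : l * ln 2 = - ln eps by rewrite /l /log2 divfK ?gt_eqF // div1r lnV // posrE.
have l0 : 0 <= l by rewrite -(pmulr_lge0 _ ln20) lE oppr_ge0 ln_le0 // ltW.
have /andP [el le] : (Num.trunc l)%:R <= l < e%:R by rewrite truncn_itv.
split; last by rewrite -natr1 lerD2r.
rewrite -ler_ln ?posrE ?invr_gt0 ?exprn_gt0 // lnV ?posrE ?exprn_gt0 // lnXn //.
rewrite lerNl -lE -[leRHS]mulr_natl ler_pM2r // ltW //.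
Qed.

Lemma log2V_le (R : realType) (x y : R) :
  0 < x -> x <= y -> log2 (1 / y) <= log2 (1 / x).
Proof.
move=> x0 xy; have y0 := lt_le_trans x0 xy.
rewrite /log2 ler_pM2r ?invr_gt0 ?ln_gt0 ?ltr1n // ler_ln ?posrE ?divr_gt0 //.
by rewrite !div1r lef_pV2 ?posrE.
Qed.

Lemma log2V_gt0 (R : realType) (x : R) : 0 < x < 1 -> 0 < log2 (1 / x).
Proof.
move=> /andP [x0 x1]; rewrite /log2 divr_gt0 ?ln_gt0 ?ltr1n //.
by rewrite div1r invf_gt1.
Qed.

(** * Choice of the constant and the cases of large and small error *)

Theorem theorem4p2 (R : realType) :
  exists C : R, 0 < C /\
  forall (eps : R) (n k d : nat) (X : bits n -> R) (L : bits n -> bits d),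
    0 < eps < 1 ->
    is_affine_source X k ->
    C * log2 (1 / eps) <= k%:R ->
    (d <= n)%N ->
    is_affine_map L ->
    (forall y : bits d, law X L y = unif R [set: bits d]%SET y) ->
    exists (a : nat) (AffineAdvGen : bits n * bits d -> bits a),
      a%:R <= Num.max 1 (C * log2 (1 / eps)) /\
      forall A : bits n -> bits n,
        is_affine_map A ->
        (forall x, A x <> x) ->
        1 - eps <=
        Pr X [pred x | AffineAdvGen (x, L x)
                       != AffineAdvGen (A x, L (A x))].
Proof.
pose q : R := 1 - 2 ^- 20.
have q20 : 0 < (2 ^- 20 : R) < 1.
  by rewrite invr_gt0 exprn_gt0 //= invf_lt1 ?exprn_gt0 // exprn_egt1 // ltr1n.
have q01 : 0 < q < 1 by rewrite /q; lra.
pose c0 := log2 (1 / q); have c00 : 0 < c0 by exact: log2V_gt0.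
have C0 : 0 < 2 + 40 / c0 by rewrite addr_gt0 // divr_gt0.
(* For [eps < q] the logarithm is at least [c0], so the term [40 / c0] absorbs all additive
   constants. *)
exists (2 + 40 / c0); split=> // eps n k d X L eps01 [S [affS XE]] lek _ _ _.
have -> : X = unif R S by apply/funext.
have [v [F [F' [FK ->]]]] := affine_subspace_param affS.
suff [a [g [aC gP]]] : exists (a : nat) (g : bits n -> bits a),
    a%:R <= Num.max 1 ((2 + 40 / c0) * log2 (1 / eps)) /\
    forall A, is_affine_map A -> (forall x, A x <> x) ->
    1 - eps <= #|[set u | g (param v F u) != g (A (param v F u))]|%:R / (2 ^ k)%:R.
  exists a, (fun xy => g xy.1); split=> // A afA fixA.
  by rewrite (Pr_unif_image R _ (param_inj (v := v) FK)) card_bits; exact: gP.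
have k0 : 0 < (2 ^ k)%:R :> R by rewrite ltr0n expn_gt0.
have [qeps|epsq] := lerP q eps.
  (* For [eps >= q] it suffices that a fraction [2^-20] of the source is separated. *)
  have few m : (2 ^ k <= m * 2 ^ 20)%N -> 1 - eps <= m%:R / (2 ^ k)%:R.
    move=> le; apply: (@le_trans _ _ (2 ^- 20)); first by rewrite /q in qeps; lra.
    by rewrite ler_pdivlMr // mulrC ler_pdivrMr ?exprn_gt0 // -natrX -natrM ler_nat.
  have [k20|k20] := leqP 20 k.
    have [|g gP] := exists_advgen v FK _ (union_bound_one_bit k20); first exact: leq_subr.
    exists 1%N, g; split=> [|A afA fixA]; first by rewrite le_max lexx.
    apply: few; have := gP A afA fixA.
    have le2 : (2 ^ (k - 5) <= 2 ^ k)%N by rewrite leq_exp2l // leq_subr.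
    rewrite subKn // => lt; apply: leq_trans (leq_mul (ltnW lt) (leqnn _)).
    by rewrite -expnD leq_exp2l //; move: k20; clear; lia.
  (* Here the source has fewer than [2^20] points, so separating the single point [v = param 0] from
     its image is enough. *)
  exists 1%N, (fun x => if x == v then const_mx 1 else 0).
  split=> [|A afA fixA]; first by rewrite le_max lexx.
  apply: few; apply: (@leq_trans (1 * 2 ^ 20)); first by rewrite mul1n leq_exp2l // ltnW.
  rewrite leq_mul2r; apply/orP; right; apply/card_gt0P; exists 0.
  rewrite inE /param mulmx0 add0r eqxx; have /eqP /negPf -> := fixA v.
  by apply/eqP => /matrixP /(_ 0 0); rewrite !mxE.
have [] := pow2_ge_inv eps01; set e := (Num.trunc _).+1; set l := log2 _ => eeps el.
have cl : c0 <= l by apply: log2V_le; [case/andP: eps01 | exact: ltW].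
have Cl : 2 * l + 40 <= (2 + 40 / c0) * l.
  by rewrite [leRHS]mulrDl lerD2l mulrAC -mulrA ler_peMr // ler_pdivlMr // mul1r.
have ke : (20 + 2 * e <= k)%N.
  rewrite -(ler_nat R) natrD natrM; move: (le_trans Cl lek) el; clear.
  by move: e%:R k%:R l => x y z; lra.
have tN : (2 ^ (k - e) <= 2 ^ k)%N by rewrite leq_exp2l // leq_subr.
have [g gP] := exists_advgen v FK tN (union_bound_small_eps ke).
exists (2 * (e + 3))%N, g; split=> [|A afA fixA].
  rewrite le_max; apply/orP; right; apply: le_trans Cl.
  by rewrite natrM natrD; move: el; clear; move: e%:R l => x y; lra.
apply: (@le_trans _ _ (1 - 2 ^- e)); first by rewrite lerD2l lerN2.
rewrite ler_pdivlMr // mulrBl mul1r.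
have -> : 2 ^- e * (2 ^ k)%:R = (2 ^ (k - e))%:R :> R.
  have ek : (e <= k)%N by move: ke; clear; lia.
  by rewrite -{1}(subnKC ek) expnD natrM natrX mulKf // expf_neq0 // pnatr_eq0.
by rewrite -natrB // ler_nat ltnW // gP.
Qed.
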